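(* For a system $(\mathrm D)$ the following statements are equivalent: (1) the first projectively reduced system of $(\mathrm D)$ is projectively nonsingular; (2) the straight line $x=0$ consists of trajectories of $(\mathrm D)$; (3) the straight line $\zeta=0$ consists of trajectories of the second projectively reduced system of $(\mathrm D)$.
   Context: System $(\mathrm D)$ of degree $n$: $\frac{dx}{dt}=X(x,y)=\sum_{k=0}^n X_k(x,y)$, $\frac{dy}{dt}=Y(x,y)=\sum_{k=0}^n Y_k(x,y)$, where $X_k,Y_k$ are real homogeneous polynomials of degree $k$, $X_n$ and $Y_n$ are not both identically zero, and $X,Y$ are relatively prime (no common divisors other than real numbers). Put $W_n(x,y)=xY_n(x,y)-yX_n(x,y)$. The system is projectively nonsingular if $W_n\not\equiv 0$ on $\mathbb{R}^2$, and projectively singular otherwise. The same terminology applies to polynomial systems in other variables (in the given order): e.g. if $\frac{d\xi}{d\tau}=\Xi(\xi,\theta)$, $\frac{d\theta}{d\tau}=\Theta(\xi,\theta)$ has degree $N$ and $\Xi_N,\Theta_N$ are the homogeneous parts of degree $N$, it is projectively nonsingular iff $\xi\Theta_N-\theta\Xi_N\not\equiv0$. Reduced systems. The substitution $x=\frac1\theta$, $y=\frac{\xi}{\theta}$ turns $(\mathrm D)$ into $\frac{d\xi}{dt}=\theta^{-m}\Xi(\xi,\theta)$, $\frac{d\theta}{dt}=\theta^{-m}\Theta(\xi,\theta)$ with $m$ an integer and $\Xi,\Theta$ polynomials not both divisible by $\theta$; the first projectively reduced system is $\frac{d\xi}{d\tau}=\Xi$, $\frac{d\theta}{d\tau}=\Theta$.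 The substitution $x=\frac{\zeta}{\eta}$, $y=\frac1\eta$ turns $(\mathrm D)$ into $\frac{d\eta}{dt}=\eta^{-m}H(\eta,\zeta)$, $\frac{d\zeta}{dt}=\eta^{-m}Z(\eta,\zeta)$ with $H,Z$ polynomials not both divisible by $\eta$; the second projectively reduced system is $\frac{d\eta}{d\nu}=H$, $\frac{d\zeta}{d\nu}=Z$. A line consists of trajectories if it is invariant: $x=0$ for $(\mathrm D)$ means $X(0,y)\equiv0$, and $\zeta=0$ for the second reduced system means $Z(\eta,0)\equiv0$. *)

(* Defs.v *)
From HB Require Import structures.
From mathcomp Require Import all_boot all_order all_algebra.
(* mpoly has to be imported before the analysis files: in the other order
   their notations are declared at incompatible levels. *)
From mathcomp Require Import mpoly.
From mathcomp Require Import classical_sets reals topology normedtype derive.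

Set Implicit Arguments.
Unset Strict Implicit.
Unset Printing Implicit Defensive.

Import Order.TTheory GRing.Theory Num.Theory.
Import numFieldNormedType.Exports.

Local Open Scope ring_scope.

(* A polynomial system u' = P(u, v), v' = Q(u, v) in two ordered variables is
   given by P, Q : {mpoly R[2]}; index 0 is the variable u, index 1 is v. *)

Definition var0 {R : realType} : {mpoly R[2]} := 'X_(Ordinal (isT : (0 < 2)%N)).
Definition var1 {R : realType} : {mpoly R[2]} := 'X_(Ordinal (isT : (1 < 2)%N)).

Definition eval2 {R : realType} (p : {mpoly R[2]}) (u v : R) : R :=
  p.@[fun i : 'I_2 => if val i == 0%N then u else v].

Definition hpart {R : realType} (k : nat) (p : {mpoly R[2]}) : {mpoly R[2]} :=
  pihomog mdeg k p.

Definition mp_divides {R : realType} (d p : {mpoly R[2]}) : Prop :=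
  exists q, p = d * q.

(* msize p is 1 + the total degree of p (and 0 for p = 0). *)
Definition has_degree {R : realType} (P Q : {mpoly R[2]}) (n : nat) : Prop :=
  [/\ (msize P <= n.+1)%N, (msize Q <= n.+1)%N
    & ~ (hpart n P = 0 /\ hpart n Q = 0)].

Definition rel_prime {R : realType} (P Q : {mpoly R[2]}) : Prop :=
  forall d, mp_divides d P -> mp_divides d Q -> exists c : R, d = c%:MP.

Definition systemD {R : realType} (n : nat) (X Y : {mpoly R[2]}) : Prop :=
  has_degree X Y n /\ rel_prime X Y.

Definition Wpoly {R : realType} (n : nat) (P Q : {mpoly R[2]}) : {mpoly R[2]} :=
  var0 * hpart n Q - var1 * hpart n P.

Definition proj_nonsingular {R : realType} (P Q : {mpoly R[2]}) : Prop :=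
  exists2 n, has_degree P Q n & exists u v : R, eval2 (Wpoly n P Q) u v != 0.

(* The curve (u, v) satisfies u' = F(u, v), v' = G(u, v) at time t. *)
Definition solves_at {R : realType} (F G : R -> R -> R) (u v : R -> R) (t : R)
  : Prop :=
  is_derive t 1 u (F (u t) (v t)) /\ is_derive t 1 v (G (u t) (v t)).

(* "The substitution x = 1/theta, y = xi/theta turns (D) into
   xi' = theta^-m Xi, theta' = theta^-m Theta": along any curve (xi, theta), at
   any time where theta does not vanish, the two systems hold simultaneously.
   No sign of m is assumed; _ ^ _ is the integer power. *)
Definition first_reduced {R : realType} (X Y Xi Theta : {mpoly R[2]}) : Prop :=
  ~ (mp_divides var1 Xi /\ mp_divides var1 Theta) /\
  exists m : int, forall (xi theta : R -> R) (t : R), theta t != 0 ->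
    (solves_at (eval2 X) (eval2 Y)
       (fun s => 1 / theta s) (fun s => xi s / theta s) t
     <->
     solves_at (fun a b => b ^ (- m) * eval2 Xi a b)
               (fun a b => b ^ (- m) * eval2 Theta a b) xi theta t).

(* Same with x = zeta/eta, y = 1/eta; the variables are ordered (eta, zeta). *)
Definition second_reduced {R : realType} (X Y H Z : {mpoly R[2]}) : Prop :=
  ~ (mp_divides var0 H /\ mp_divides var0 Z) /\
  exists m : int, forall (eta zeta : R -> R) (t : R), eta t != 0 ->
    (solves_at (eval2 X) (eval2 Y)
       (fun s => zeta s / eta s) (fun s => 1 / eta s) t
     <->
     solves_at (fun a b => a ^ (- m) * eval2 H a b)
               (fun a b => a ^ (- m) * eval2 Z a b) eta zeta t).

(* The line {first coordinate = 0} is invariant for u' = P, v' = Q. *)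
Definition line0_invariant {R : realType} (P Q : {mpoly R[2]}) : Prop :=
  forall v : R, eval2 P 0 v = 0.

(* The line {second coordinate = 0} is invariant for u' = P, v' = Q. *)
Definition line1_invariant {R : realType} (P Q : {mpoly R[2]}) : Prop :=
  forall u : R, eval2 Q u 0 = 0.

(* Main.v *)
Require Import Defs.
From mathcomp Require Import all_boot all_order all_algebra.
From mathcomp Require Import mpoly.
From mathcomp Require Import boolp functions reals normedtype derive.
From mathcomp Require Import ring.

(** Put p~(xi, theta) = theta^n p(1/theta, xi/theta) for a polynomial p of
    degree at most n ([infinity_chart]).  Differentiating x = 1/theta,
    y = xi/theta gives xi' = theta (Y - xi X) and theta' = - theta^2 X, so, up to
    a common power of theta, the first reduced system is
    (Y~ - xi X~, - theta X~) ([first_reduced_chart]).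

    Multiplying both components by one nonzero homogeneous polynomial does not
    affect projective nonsingularity ([proj_nonsingularM]), so the power of theta
    can be ignored and the exponent m need not be determined.  Since
    xi (- theta X~) - theta (Y~ - xi X~) = - theta Y~, the form W_k of this
    system is - theta Y~_k for every k, where Y~_k is the part of degree k; in
    particular it vanishes for k > n.  So if X~_n is nonzero, the system has
    degree n + 1 and is singular.  If X~_n = 0, then W_n = - theta Y~_n
    decides ([chart_nonsingular]).

    The part of degree n of p~ comes exactly from the monomials of p free of x:
    it is theta^n p(0, xi/theta) ([eval2_hpart_infinity_chart]).  Hence X~_n = 0
    says that x = 0 is invariant, and then Y~_n is nonzero: otherwise x would
    divide both X and Y ([rel_prime_line0]).

    For the second reduced system, Z = eta^(m+1) (X - zeta Y) at
    (zeta/eta, 1/eta), so on zeta = 0 it is eta^(m+1) X(0, 1/eta)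
    ([second_reduced_line1]); both X(0, y) and Z(eta, 0) are polynomials in one
    variable, so one vanishes identically as soon as the other does. *)

Set Implicit Arguments.
Unset Strict Implicit.
Unset Printing Implicit Defensive.

Import Order.TTheory GRing.Theory Num.Theory.
Import numFieldNormedType.Exports.

Local Open Scope ring_scope.

Local Notation i0 := (Ordinal (isT : (0 < 2)%N)).
Local Notation i1 := (Ordinal (isT : (1 < 2)%N)).

(** * Bivariate polynomials as functions *)

Section Bivariate.
Variable R : realType.
Implicit Types (p q f P Q : {mpoly R[2]}) (m : 'X_{1..2}) (u v : R) (n : nat).

Lemma mdeg2 m : mdeg m = (m i0 + m i1)%N.
Proof.
rewrite mdegE big_ord_recl big_ord1.
by congr (m _ + m _)%N; exact: val_inj.
Qed.

Lemma eval2E p u v :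
  eval2 p u v = \sum_(m <- msupp p) p@_m * (u ^+ m i0 * v ^+ m i1).
Proof.
rewrite /eval2 mevalE; apply: eq_bigr => m _; congr (_ * _).
rewrite big_ord_recl big_ord1 /=.
by congr (_ ^+ m _ * _ ^+ m _); exact: val_inj.
Qed.

Lemma eval2_var0 u v : eval2 var0 u v = u. Proof. exact: mevalXU. Qed.
Lemma eval2_var1 u v : eval2 var1 u v = v. Proof. exact: mevalXU. Qed.

Lemma eval2M p q u v : eval2 (p * q) u v = eval2 p u v * eval2 q u v.
Proof. exact: mevalM. Qed.

Lemma eval2B p q u v : eval2 (p - q) u v = eval2 p u v - eval2 q u v.
Proof. exact: mevalB. Qed.

Lemma eval2N p u v : eval2 (- p) u v = - eval2 p u v.
Proof. exact: mevalN. Qed.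

Lemma eval2Xn p k u v : eval2 (p ^+ k) u v = eval2 p u v ^+ k.
Proof. by rewrite /eval2 rmorphXn. Qed.

Lemma poly_zero_off0 (q : {poly R}) :
  (forall x, x != 0 -> q.[x] = 0) -> q = 0.
Proof.
move=> q0; apply/eqP; apply: contraT => nzq.
pose s := [seq k.+1%:R : R | k <- iota 0 (size q)].
have /(max_poly_roots nzq) : all (root q) s.
  by apply/allP=> _ /mapP[k _ ->]; apply/rootP/q0; rewrite pnatr_eq0.
rewrite size_map size_iota ltnn; apply.
rewrite map_inj_uniq ?iota_uniq // => j k /eqP.
by rewrite eqr_nat => /eqP[].
Qed.

(** Kronecker substitution: along u = v^D with D above the degree of p, distinct
    monomials of p become distinct powers of v, so p is recovered from a
    polynomial in one variable.  Points with v = 0 are excluded because the charts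
    are defined away from that line. *)
Lemma eval2_eq0 p : (forall u v, v != 0 -> eval2 p u v = 0) -> p = 0.
Proof.
move=> p0; pose D := msize p.
pose e m := (m i0 * D + m i1)%N.
pose q : {poly R} := \sum_(m <- msupp p) p@_m *: 'X^(e m).
have q0 : q = 0.
  apply: poly_zero_off0 => x /(p0 (x ^+ D)); rewrite eval2E => <-.
  rewrite horner_sum; apply: eq_bigr => m _.
  by rewrite hornerZ hornerXn exprD mulnC exprM.
have e_inj : {in msupp p &, injective e}.
  move=> m m' /msize_mdeg_lt lt_m /msize_mdeg_lt lt_m'.
  rewrite -/D mdeg2 in lt_m; rewrite -/D mdeg2 in lt_m'.
  have lt1 : (m i1 < D)%N by apply: leq_ltn_trans lt_m; apply: leq_addl.
  have lt1' : (m' i1 < D)%N by apply: leq_ltn_trans lt_m'; apply: leq_addl.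
  have D0 : (0 < D)%N by apply: leq_ltn_trans lt1.
  move=> eq_e; have := congr1 (divn^~ D) eq_e; have := congr1 (modn^~ D) eq_e.
  rewrite /e !modnMDl !divnMDl // !modn_small // !divn_small // !addn0 => e1 e0.
  apply/mnmP => -[[|[|//]] lt2].
    by rewrite (_ : Ordinal lt2 = i0) //; exact: val_inj.
  by rewrite (_ : Ordinal lt2 = i1) //; exact: val_inj.
apply/mpolyP => m; rewrite mcoeff0.
have [m_p|/memN_msupp_eq0 //] := boolP (m \in msupp p).
have := congr1 (fun r : {poly R} => r`_(e m)) q0.
rewrite coef0 coef_sum (bigD1_seq m) //= coefZ coefXn eqxx mulr1.
rewrite big_seq_cond big1 ?addr0 // => m' /andP[m'_p ne].
rewrite coefZ coefXn; case: eqP; rewrite ?mulr0 // => /e_inj eq_m.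
by rewrite eq_m ?eqxx in ne.
Qed.

(** * Homogeneous parts and projective nonsingularity *)

Lemma dhomog_var0 : (var0 : {mpoly R[2]}) \is 1.-homog.
Proof. by rewrite dhomogX; apply/eqP; exact: mdeg1. Qed.

Lemma dhomog_var1 : (var1 : {mpoly R[2]}) \is 1.-homog.
Proof. by rewrite dhomogX; apply/eqP; exact: mdeg1. Qed.

Lemma var1_neq0 : (var1 : {mpoly R[2]}) != 0.
Proof.
apply/eqP => /(congr1 (fun p => eval2 p 0 1)).
by rewrite eval2_var1 /eval2 meval0 => /eqP; rewrite oner_eq0.
Qed.

Lemma msize_leP p n :
  reflect {in msupp p, forall m, (mdeg m < n)%N} (msize p <= n)%N.
Proof.
rewrite msizeE; apply: (iffP (bigmax_leqP_seq _ _ _ _)) => h m m_p.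
  exact: h.
by move=> _; exact: h.
Qed.

Lemma hpartB n p q : hpart n (p - q) = hpart n p - hpart n q.
Proof. exact: pihomogB. Qed.

Lemma hpart_geq p n : (msize p <= n)%N -> hpart n p = 0.
Proof.
move/msize_leP => le_p; rewrite /hpart pihomogE big_seq_cond big1 //.
by move=> m /andP[/le_p lt_m /eqP eq_m]; rewrite eq_m ltnn in lt_m.
Qed.

Lemma msize_hpart0 p n : (msize p <= n.+1)%N -> hpart n p = 0 -> (msize p <= n)%N.
Proof.
move=> /msize_leP le_p p0; apply/msize_leP => m m_p.
have := le_p m m_p; rewrite ltnS leq_eqVlt => /predU1P[eq_m|//].
have /eqP[] : p@_m != 0 by rewrite -mcoeff_msupp.
have := congr1 (mcoeff m) p0.
rewrite mcoeff0 /hpart pihomogE raddf_sum big_mkcond /=.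
rewrite (bigD1_seq m) //= -eq_m eqxx mcoeffZ mcoeffX eqxx mulr1.
rewrite big1 ?addr0 // => m' ne; case: ifP => // _.
by rewrite mcoeffZ mcoeffX (negPf ne) mulr0.
Qed.

Lemma msize_dhomog d p : p \is d.-homog -> (msize p <= d.+1)%N.
Proof. by move/dhomogP => hp; apply/msize_leP => m /hp ->. Qed.

Lemma hpart_dhomogM f d k p : f \is d.-homog ->
  hpart k (f * p) = if (d <= k)%N then f * hpart (k - d) p else 0.
Proof.
move=> fd; rewrite {1}[p]mpolyE mulr_sumr /hpart raddf_sum /=.
have hom m : f * (p@_m *: 'X_[m]) \is (d + mdeg m).-homog.
  by apply: dhomogM => //; apply: dhomogZ; rewrite [_ \in _]dhomogX.
case: leqP => [le_dk|lt_kd].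
  rewrite pihomogE mulr_sumr [RHS]big_mkcond; apply: eq_bigr => m _.
  have [eq_m|ne] := eqVneq (mdeg m) (k - d)%N.
    by rewrite pihomog_dE //; move: (hom m); rewrite eq_m subnKC.
  by apply: (pihomog_ne0 _ (hom m)); rewrite -(subnKC le_dk) eqn_add2l.
apply: big1 => m _; apply: (pihomog_ne0 _ (hom m)).
by rewrite gtn_eqF // ltn_addr.
Qed.

Lemma msize_dhomogM f d p n : f \is d.-homog -> f != 0 ->
  (msize (f * p) <= (d + n).+1)%N = (msize p <= n.+1)%N.
Proof.
move=> fd nzf; have [->|nzp] := eqVneq p 0; first by rewrite mulr0 msize0.
have size_f : msize f = d.+1.
  apply/eqP; rewrite eqn_leq msize_dhomog //=.
  have := mlead_supp nzf => /[dup] /msize_mdeg_lt.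
  by move=> lt_f /(dhomog_mf fd) /= <-.
by rewrite msizeM // size_f addSn /= -addnS leq_add2l.
Qed.

Lemma msize_dhomog1M f p n : f \is 1.-homog -> (msize p <= n)%N ->
  (msize (f * p) <= n.+1)%N.
Proof.
move=> /msize_dhomog lef lep.
have [->|nzf] := eqVneq f 0; first by rewrite mul0r msize0.
have [->|nzp] := eqVneq p 0; first by rewrite mulr0 msize0.
rewrite msizeM // -ltnS prednK; first exact: (leq_add lef lep).
by rewrite addn_gt0 lt0n msize_poly_eq0 nzf.
Qed.

(** Multiplication by a variable shifts degrees by one, so W_n is a single
    homogeneous part of the fixed polynomial u Q - v P. *)
Lemma Wpoly_hpart n P Q : Wpoly n P Q = hpart n.+1 (var0 * Q - var1 * P).
Proof.
rewrite hpartB (hpart_dhomogM _ _ dhomog_var0).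
by rewrite (hpart_dhomogM _ _ dhomog_var1) /= subn1.
Qed.

(** A nonzero W_n already forces the system to have degree n, and being nonzero
    at a point is being nonzero as a polynomial. *)
Lemma proj_nonsingularP P Q : proj_nonsingular P Q <->
  exists n, [/\ (msize P <= n.+1)%N, (msize Q <= n.+1)%N & Wpoly n P Q <> 0].
Proof.
split=> [[n [leP leQ _] [u [v W]]]|[n [leP leQ W]]]; exists n.
- by split=> // W0; rewrite W0 /eval2 meval0 eqxx in W.
- split=> // -[P0 Q0]; apply: W.
  by rewrite /Wpoly P0 Q0 !mulr0 subr0.
- apply: contrapT => no; apply: W; apply: eval2_eq0 => u v _.
  by apply/eqP; apply: contraT => W; case: no; exists u, v.
Qed.

Lemma Wpoly_dhomogM n f d P Q : f \is d.-homog ->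
  Wpoly n (f * P) (f * Q) = if (d <= n)%N then f * Wpoly (n - d) P Q else 0.
Proof.
move=> fd; rewrite !Wpoly_hpart.
have -> : var0 * (f * Q) - var1 * (f * P) = f * (var0 * Q - var1 * P) by ring.
rewrite (hpart_dhomogM _ _ fd); case: (leqP d n) => [le_dn|lt_nd].
  by rewrite leqW // subSn.
case: leqP => // le_d; have -> : (n.+1 - d = 0)%N by apply/eqP; rewrite subn_eq0.
rewrite hpartB (hpart_dhomogM _ _ dhomog_var0) (hpart_dhomogM _ _ dhomog_var1).
by rewrite subr0 mulr0.
Qed.

(** Everything is shifted by the degree of f, so the reduced systems may be
    studied up to a power of theta. *)
Lemma proj_nonsingularM f d P Q : f \is d.-homog -> f != 0 ->
  proj_nonsingular (f * P) (f * Q) <-> proj_nonsingular P Q.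
Proof.
move=> fd nzf; split=> /proj_nonsingularP[n [leP leQ W]];
  apply/proj_nonsingularP.
  move: W; rewrite (Wpoly_dhomogM _ _ _ fd); case: leqP => // le_dn W.
  rewrite -(subnKC le_dn) !(msize_dhomogM _ _ fd) // in leP leQ.
  by exists (n - d)%N; split=> // W0; apply: W; rewrite W0 mulr0.
exists (d + n)%N; rewrite !(msize_dhomogM _ _ fd) //; split=> //.
rewrite (Wpoly_dhomogM _ _ _ fd) leq_addr addKn => /eqP.
by rewrite mulf_eq0 (negPf nzf) => /eqP.
Qed.

(** * The chart x = 1/theta, y = xi/theta *)

(* The monomial x^i y^j becomes theta^n (1/theta)^i (xi/theta)^j; the truncated
   subtraction is exact when the degree i + j is at most n. *)
Local Notation chart_mon n m := (var0 ^+ m i1 * var1 ^+ (n - mdeg m)).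

(** The polynomial theta^n p(1/theta, xi/theta), for p of degree at most n; the
    variables are xi = var0 and theta = var1. *)
Definition infinity_chart n p : {mpoly R[2]} :=
  \sum_(m <- msupp p) p@_m *: chart_mon n m.

Lemma dhomog_chart_mon n m :
  (chart_mon n m : {mpoly R[2]}) \is (m i1 + (n - mdeg m)).-homog.
Proof.
have := dhomogM (dhomogMn (m i1) dhomog_var0)
                (dhomogMn (n - mdeg m) dhomog_var1).
by rewrite !mul1n.
Qed.

Lemma eval2_sum_chart n p (A : pred 'X_{1..2}) u v :
  eval2 (\sum_(m <- msupp p | A m) p@_m *: chart_mon n m) u v =
  \sum_(m <- msupp p | A m) p@_m * (u ^+ m i1 * v ^+ (n - mdeg m)).
Proof.
rewrite {1}/eval2 raddf_sum /=; apply: eq_bigr => m _.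
rewrite mevalZ -/(eval2 _ u v) eval2M !eval2Xn.
by rewrite eval2_var0 eval2_var1.
Qed.

Lemma msize_infinity_chart n p : (msize p <= n.+1)%N ->
  (msize (infinity_chart n p) <= n.+1)%N.
Proof.
move=> /msize_leP le_p; rewrite /infinity_chart big_seq.
apply: (leq_trans (msize_sum _ _ _)); apply/bigmax_leqP_seq => m m_p _.
apply: (leq_trans (msizeZ_le _ _)).
apply: (leq_trans (msize_dhomog (dhomog_chart_mon n m))).
have := le_p m m_p; rewrite !ltnS => le_m.
rewrite addnBA // leq_subLR leq_add2r mdeg2; exact: leq_addl.
Qed.

Lemma eval2_infinity_chart n p u v : (msize p <= n.+1)%N -> v != 0 ->
  eval2 (infinity_chart n p) u v = v ^+ n * eval2 p (1 / v) (u / v).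
Proof.
move=> /msize_leP le_p nzv; rewrite eval2_sum_chart eval2E mulr_sumr.
apply: eq_big_seq => m /le_p; rewrite ltnS => le_m.
rewrite [RHS]mulrCA; congr (_ * _).
rewrite -[n in RHS](subnK le_m) exprD mdeg2 exprD !expr_div_n expr1n.
by field; rewrite !expf_neq0.
Qed.

(** The image of x^i y^j has degree n - i, which is n only when i = 0. *)
Lemma hpart_infinity_chart n p : (msize p <= n.+1)%N ->
  hpart n (infinity_chart n p) =
  \sum_(m <- msupp p | m i0 == 0%N) p@_m *: chart_mon n m.
Proof.
move=> /msize_leP le_p; rewrite /hpart /infinity_chart raddf_sum /=.
rewrite [RHS]big_mkcond; apply: eq_big_seq => m /le_p; rewrite ltnS => le_m.
have hom : p@_m *: chart_mon n m \is (m i1 + (n - mdeg m)).-homog.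
  by apply: dhomogZ; exact: dhomog_chart_mon.
have deg : (m i0 + (m i1 + (n - mdeg m)) = n)%N.
  by rewrite addnA -mdeg2 subnKC.
case: eqP => [m0|/eqP m0].
  by rewrite pihomog_dE //; move: hom; rewrite -{4}deg m0.
apply: (pihomog_ne0 _ hom); rewrite -[X in _ != X]deg -[X in X != _]add0n eqn_add2r.
by rewrite eq_sym.
Qed.

Lemma eval2_0 p v :
  eval2 p 0 v = \sum_(m <- msupp p | m i0 == 0%N) p@_m * v ^+ m i1.
Proof.
rewrite eval2E [RHS]big_mkcond; apply: eq_bigr => m _.
by rewrite expr0n; case: eqP => _; rewrite ?mul1r ?mul0r ?mulr0.
Qed.

Lemma eval2_hpart_infinity_chart n p u v : (msize p <= n.+1)%N -> v != 0 ->
  eval2 (hpart n (infinity_chart n p)) u v = v ^+ n * eval2 p 0 (u / v).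
Proof.
move=> le_p nzv; rewrite hpart_infinity_chart // eval2_sum_chart eval2_0.
rewrite mulr_sumr big_seq_cond [RHS]big_seq_cond.
apply: eq_bigr => m /andP[/(msize_leP _ _ le_p)].
rewrite ltnS mdeg2 => le_m /eqP m0; rewrite m0 add0n in le_m *.
rewrite [RHS]mulrCA; congr (_ * _).
rewrite -[n in RHS](subnK le_m) exprD !expr_div_n.
by field; rewrite expf_neq0.
Qed.

Lemma hpart_infinity_chart_eq0 n p : (msize p <= n.+1)%N ->
  hpart n (infinity_chart n p) = 0 <-> (forall v, eval2 p 0 v = 0).
Proof.
move=> le_p; split=> [h0 v|p0].
  have := eval2_hpart_infinity_chart v le_p (oner_neq0 R).
  by rewrite h0 /eval2 meval0 expr1n mul1r divr1.
apply: eval2_eq0 => u v nzv.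
by rewrite eval2_hpart_infinity_chart // p0 mulr0.
Qed.

(** The monomials of p free of u form a polynomial that takes the values
    p(0, v), hence vanishes; u divides all the others. *)
Lemma var0_divides p : (forall v, eval2 p 0 v = 0) -> mp_divides var0 p.
Proof.
move=> p0; pose r := \sum_(m <- msupp p | m i0 == 0%N) p@_m *: 'X_[m].
have Xm m : 'X_[m] = var0 ^+ m i0 * var1 ^+ m i1 :> {mpoly R[2]}.
  rewrite [LHS]mpolyXE_id big_ord_recl big_ord1.
  by congr ('X_(_) ^+ m _ * 'X_(_) ^+ m _); exact: val_inj.
have r0 : r = 0.
  apply: eval2_eq0 => u v _; rewrite -(p0 v) eval2_0 /eval2 raddf_sum /=.
  apply: eq_bigr => m /eqP m0.
  rewrite mevalZ Xm m0 expr0 mul1r; congr (_ * _).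
  by rewrite -/(eval2 _ u v) eval2Xn eval2_var1.
exists (\sum_(m <- msupp p | m i0 != 0%N)
          p@_m *: (var0 ^+ (m i0).-1 * var1 ^+ m i1)).
rewrite {1}[p]mpolyE (bigID (fun m : 'X_{1..2} => m i0 == 0%N)) /= -/r r0 add0r.
rewrite mulr_sumr; apply: eq_bigr => m; rewrite -lt0n => m0.
by rewrite -scalerAr mulrA -exprS prednK // Xm.
Qed.

Lemma rel_prime_line0 P Q : rel_prime P Q ->
  ~ ((forall v, eval2 P 0 v = 0) /\ (forall v, eval2 Q 0 v = 0)).
Proof.
move=> cop [/var0_divides P0 /var0_divides Q0].
have [c var0c] := cop _ P0 Q0.
have := eval2_var0 1 0; have := eval2_var0 0 0.
rewrite var0c /eval2 !mevalC => -> /eqP.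
by rewrite eq_sym oner_eq0.
Qed.

(** The polynomial u (- v P) - v (Q - u P) collapses to - v Q, of degree at most
    n + 1, while the part of degree n + 1 of - v P is - v P_n.  So a nonzero W_k has
    k <= n, and the degree bound k on the system forces P_n = 0. *)
Lemma chart_nonsingular n P Q :
  (msize P <= n.+1)%N -> (msize Q <= n.+1)%N ->
  (hpart n P = 0 -> hpart n Q <> 0) ->
  proj_nonsingular (Q - var0 * P) (- (var1 * P)) <-> hpart n P = 0.
Proof.
move=> leP leQ nz.
have WE k : Wpoly k (Q - var0 * P) (- (var1 * P)) = - (var1 * hpart k Q).
  rewrite Wpoly_hpart.
  have -> : var0 * - (var1 * P) - var1 * (Q - var0 * P) = var1 * (- Q) by ring.
  rewrite (hpart_dhomogM _ _ dhomog_var1) subn1 /=.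
  by rewrite /hpart pihomogN mulrN.
split=> [/proj_nonsingularP[k [_ lev W]]|P0].
  have le_kn : (k <= n)%N.
    rewrite leqNgt; apply/negP => lt_nk; apply: W.
    by rewrite WE hpart_geq ?mulr0 ?oppr0 //; apply: leq_trans leQ _.
  have := hpart_geq (leq_trans lev (le_kn : (k < n.+1)%N)).
  rewrite /hpart pihomogN -/(hpart _ _) (hpart_dhomogM _ _ dhomog_var1).
  rewrite subn1 /= => /eqP; rewrite oppr_eq0 mulf_eq0 (negPf (var1_neq0)).
  by move/eqP.
have leP' := msize_hpart0 leP P0.
apply/proj_nonsingularP; exists n; split.
- apply: (leq_trans (msizeD_le _ _)); rewrite geq_max leQ msizeN.
  by rewrite (msize_dhomog1M dhomog_var0).
- by rewrite msizeN (msize_dhomog1M dhomog_var1).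
- rewrite WE => /eqP; rewrite oppr_eq0 mulf_eq0 (negPf (var1_neq0)).
  by move/eqP; apply: nz.
Qed.

End Bivariate.

(** * Velocities in a chart *)

Section ChartVelocities.
Variable R : realType.
Implicit Types (f g u v : R -> R) (F G A B : R -> R -> R).

Lemma is_derive_div f g (t df dg : R) : g t != 0 ->
  is_derive t 1 f df -> is_derive t 1 g dg ->
  is_derive t 1 (fun s => f s / g s) ((df * g t - f t * dg) / g t ^+ 2).
Proof.
move=> nzg fd gd.
have gV : is_derive t 1 (fun s => (g s)^-1) (- g t ^- 2 * dg).
  apply: DeriveDef; first exact: derivableV.
  by rewrite deriveV // derive_val.
apply: (@is_derive_eq _ _ _ _ _ _ _ _ (is_deriveM fd gV)).
by rewrite /GRing.scale /=; field.
Qed.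

Lemma is_derive_line (a c : R) : is_derive (0 : R) 1 (fun s => a + s * c) c.
Proof.
have h := is_deriveD (is_derive_cst a (0 : R) 1)
  (is_deriveM (is_derive_id (0 : R) 1) (is_derive_cst c (0 : R) 1)).
apply: (is_derive_eq h).
by rewrite /GRing.scale /= /cst; ring.
Qed.

(** Give a straight line through (a, b) the velocity that the chain rule predicts
    from (F, G).  Its image under (u, v) -> (1/v, u/v) then satisfies the system
    (F, G) at time 0, so the line itself satisfies (A, B) there, and its velocity
    is the value of (A, B). *)
Lemma chart_velocities F G A B :
  (forall u v t, v t != 0 ->
     solves_at F G (fun s => 1 / v s) (fun s => u s / v s) t ->
     solves_at A B u v t) ->
  forall a b, b != 0 ->
    A a b = b * (G (1 / b) (a / b) - a * F (1 / b) (a / b)) /\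
    B a b = - (b ^+ 2 * F (1 / b) (a / b)).
Proof.
move=> h a b nzb; set x := F _ _; set y := G _ _.
pose du := b * (y - a * x); pose dv := - (b ^+ 2 * x).
pose u s := a + s * du; pose v s := b + s * dv.
have ud : is_derive (0 : R) 1 u du by exact: is_derive_line.
have vd : is_derive (0 : R) 1 v dv by exact: is_derive_line.
have u0 : u 0 = a by rewrite /u mul0r addr0.
have v0 : v 0 = b by rewrite /v mul0r addr0.
have nzv : v 0 != 0 by rewrite v0.
have [|ud' vd'] := h u v 0 nzv.
  rewrite /solves_at u0 v0 -/x -/y; split.
    have := is_derive_div nzv (is_derive_cst (1 : R) (0 : R) 1) vd.
    by move=> d; apply: (is_derive_eq d); rewrite v0 /cst /dv; field.
  have := is_derive_div nzv ud vd.
  by move=> d; apply: (is_derive_eq d); rewrite v0 u0 /du /dv; field.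
rewrite u0 v0 in ud' vd'; split.
  by have := @derive_val _ _ _ _ _ _ _ ud'; rewrite (@derive_val _ _ _ _ _ _ _ ud).
by have := @derive_val _ _ _ _ _ _ _ vd'; rewrite (@derive_val _ _ _ _ _ _ _ vd).
Qed.

End ChartVelocities.

(** Two exponents j and k replace the integer power theta^(m + 1 - n), whose
    sign is unknown. *)
Lemma first_reduced_chart (R : realType) (n : nat) (X Y Xi Theta : {mpoly R[2]}) :
  (msize X <= n.+1)%N -> (msize Y <= n.+1)%N ->
  first_reduced X Y Xi Theta ->
  exists j k, var1 ^+ j * Xi =
      var1 ^+ k * (infinity_chart n Y - var0 * infinity_chart n X) /\
    var1 ^+ j * Theta = var1 ^+ k * - (var1 * infinity_chart n X).
Proof.
move=> leX leY [_ [m red]].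
have vel := chart_velocities (fun u v t nzv => (red u v t nzv).1).
(* Both sides of theta^(-m) w = theta z are multiplied by theta^n, and also by
   theta^m when m >= 0, so that only natural exponents remain. *)
pose jk := if m is Posz l then (n, l.+1) else (n + `|m|, 1)%N.
have powers b (w z : R) : b != 0 ->
    b ^ (- m) * w = b * z -> b ^+ jk.1 * w = b ^+ jk.2 * (b ^+ n * z).
  rewrite /jk; case: m {red vel jk} => [l|l] nzb e.
    have -> : w = b ^+ l * (b * z).
      by rewrite -e mulrA [b ^+ l]exprnP -expfzDr // subrr expr0z mul1r.
    by rewrite /= exprS; ring.
  have {}e : b ^+ l.+1 * w = b * z := e.
  by rewrite /= exprD -mulrA e expr1; ring.
exists jk.1, jk.2; split; apply/eqP; rewrite -subr_eq0; apply/eqP;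
  apply: eval2_eq0 => a b nzb; have [velXi velTheta] := vel a b nzb;
  apply/eqP; rewrite eval2B subr_eq0; apply/eqP;
  rewrite !(eval2M, eval2Xn, eval2B, eval2N, eval2_var0, eval2_var1);
  rewrite !eval2_infinity_chart //.
- by rewrite (powers _ _ _ nzb velXi); ring.
- rewrite (powers b _ (- (b * eval2 X (1 / b) (a / b)))) //; first by ring.
  by rewrite velTheta; ring.
Qed.

(** The second substitution is the first one with the roles of the two
    coordinates exchanged in both systems. *)
Lemma second_reduced_line1 (R : realType) (X Y H Z : {mpoly R[2]}) :
  second_reduced X Y H Z ->
  forall b, b != 0 -> eval2 Z b 0 = 0 <-> eval2 X 0 (1 / b) = 0.
Proof.
move=> [_ [m red]] b nzb.
have [|velZ _] := @chart_velocities R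
    (fun x y => eval2 Y y x) (fun x y => eval2 X y x)
    (fun a b => b ^ (- m) * eval2 Z b a) (fun a b => b ^ (- m) * eval2 H b a)
    _ 0 b nzb.
  move=> u v t nzv [d1 d2].
  by have [? ?] := (red v u t nzv).1 (conj d2 d1).
rewrite /= !mul0r subr0 in velZ.
by split=> e0; move/eqP: velZ; rewrite e0 mulr0 ?(eq_sym 0) mulf_eq0
  ?expfz_eq0 (negPf nzb) ?andbF => /eqP.
Qed.

(** * The equivalences *)

Lemma eval2_line0_off0 (R : realType) (p : {mpoly R[2]}) (u : R) :
  (forall v, v != 0 -> eval2 p u v = 0) -> forall v, eval2 p u v = 0.
Proof.
pose q : {poly R} := \sum_(m <- msupp p) (p@_m * u ^+ m i0) *: 'X^(m i1).
have qE v : eval2 p u v = q.[v].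
  rewrite eval2E horner_sum; apply: eq_bigr => m _.
  by rewrite hornerZ hornerXn mulrA.
move=> p0 v; rewrite qE (poly_zero_off0 (q := q)) ?horner0 // => x /p0.
by rewrite qE.
Qed.

Lemma eval2_line1_off0 (R : realType) (p : {mpoly R[2]}) (v : R) :
  (forall u, u != 0 -> eval2 p u v = 0) -> forall u, eval2 p u v = 0.
Proof.
pose q : {poly R} := \sum_(m <- msupp p) (p@_m * v ^+ m i1) *: 'X^(m i0).
have qE u : eval2 p u v = q.[u].
  rewrite eval2E horner_sum; apply: eq_bigr => m _.
  by rewrite hornerZ hornerXn -mulrA; congr (_ * _); rewrite mulrC.
move=> p0 u; rewrite qE (poly_zero_off0 (q := q)) ?horner0 // => x /p0.
by rewrite qE.
Qed.

Theorem mainTheorem19 (R : realType) (n : nat)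
  (X Y Xi Theta H Z : {mpoly R[2]}) :
  systemD n X Y ->
  first_reduced X Y Xi Theta ->
  second_reduced X Y H Z ->
  (proj_nonsingular Xi Theta <-> line0_invariant X Y) /\
  (line0_invariant X Y <-> line1_invariant H Z).
Proof.
move=> [[leX leY _] cop] red1 red2; split.
  have [j [k [eXi eTheta]]] := first_reduced_chart leX leY red1.
  have hom i : (var1 ^+ i : {mpoly R[2]}) \is i.-homog.
    by have := dhomogMn i (@dhomog_var1 R); rewrite mul1n.
  have nz i : (var1 ^+ i : {mpoly R[2]}) != 0.
    by rewrite expf_neq0 ?var1_neq0.
  rewrite -(proj_nonsingularM _ _ (hom j) (nz j)) eXi eTheta.
  rewrite (proj_nonsingularM _ _ (hom k) (nz k)).
  have leX' := msize_infinity_chart leX; have leY' := msize_infinity_chart leY.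
  rewrite (chart_nonsingular leX' leY'); first exact: hpart_infinity_chart_eq0.
  move=> /(hpart_infinity_chart_eq0 leX) X0 /(hpart_infinity_chart_eq0 leY) Y0.
  exact: (rel_prime_line0 cop).
have line := second_reduced_line1 red2; split=> inv.
  by apply: eval2_line1_off0 => b nzb; apply/line.
apply: eval2_line0_off0 => v nzv.
have nzb : v^-1 != 0 by rewrite invr_eq0.
by have := (line _ nzb).1 (inv _); rewrite div1r invrK.
Qed.
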